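(* Let $f,g:\mathbb{R}\to\mathbb{R}$ be nonrandom continuous functions with $|f(u)|,|g(u)|\le1$ for all $u\in\mathbb{R}$, and let $\{\xi_n\}_{n\ge1}$ be random variables satisfying the noise assumption below. Suppose that $$\sup_{u\in\mathbb{R}\setminus\{0\}}\left\{\frac{2f(u)}{g^2(u)}\right\}=\beta<1,$$ where, at points $u\neq0$ with $g(u)=0$, this condition is understood to hold at $u$ if and only if $f(u)<0$ (so no restriction on $g$ is imposed when $f(u)<0$ for all $u\ne 0$). Then there exists $h_0>0$ such that for every $h\in(0,h_0)$ and every nonrandom $x_0\in\mathbb{R}$, the solution of $$x_{n+1}=x_n\big(1+hf(x_n)+\sqrt{h}\,g(x_n)\xi_{n+1}\big),\quad n=0,1,\dots,$$ satisfies $\lim_{n\to\infty}x_n=0$ almost surely.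
   Context: Noise assumption (Assumption 1): the $\xi_n$ are independent with $\mathbf{E}\xi_n=0$, $\mathbf{E}\xi_n^2=1$, $\mathbf{E}|\xi_n|^3$ uniformly bounded in $n$; each $\xi_n$ has a probability density $p_n$, and $x^3p_n(x)\to0$ as $|x|\to\infty$ uniformly in $n$. *)

(* Defs.v *)
From HB Require Import structures.
From mathcomp Require Import all_boot all_order all_algebra.
From mathcomp Require Import all_classical all_reals all_analysis.
Set Implicit Arguments. Unset Strict Implicit. Unset Printing Implicit Defensive.
Import Order.TTheory GRing.Theory Num.Theory.
Import numFieldNormedType.Exports.
Local Open Scope classical_set_scope.
Local Open Scope ring_scope.

Definition mutually_independent d (T : measurableType d) (R : realType)
  (P : probability T R) (xi : nat -> {RV P >-> R}) : Prop :=
  forall (s : seq nat) (B : nat -> set R),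
    uniq s -> (forall i, measurable (B i)) ->
    P (\bigcap_(i in [set` s]) (xi i @^-1` B i)) =
    (\prod_(i <- s) P (xi i @^-1` B i))%E.

Definition is_density d (T : measurableType d) (R : realType)
  (P : probability T R) (X : {RV P >-> R}) (p : R -> R) : Prop :=
  measurable_fun setT p /\ (forall y, 0 <= p y) /\
  forall A : set R, measurable A ->
    distribution P X A = (\int[lebesgue_measure]_(y in A) (p y)%:E)%E.

Definition noise_assumption d (T : measurableType d) (R : realType)
  (P : probability T R) (xi : nat -> {RV P >-> R}) : Prop :=
  [/\ mutually_independent xi,
      (forall n, ('E_P[xi n] = 0)%E),
      (forall n, ('E_P[(fun w => (xi n w ^+ 2)%R)] = 1)%E),
      (exists C : R, forall n, ('E_P[(fun w => (`|xi n w| ^+ 3)%R)] <= C%:E)%E) &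
      exists p : nat -> R -> R,
        (forall n, is_density (xi n) (p n)) /\
        (forall eps : R, 0 < eps -> exists M : R, forall n (y : R),
            M < `|y| -> `|y ^+ 3 * p n y| < eps)].

(* The solution of x_{n+1} = x_n (1 + h f(x_n) + sqrt h g(x_n) xi_{n+1}),
   x_0 = x0.  Here xi n plays the role of the paper's xi_{n+1}. *)
Fixpoint sol d (T : measurableType d) (R : realType) (P : probability T R)
  (f g : R -> R) (h x0 : R) (xi : nat -> {RV P >-> R}) (n : nat) (w : T) : R :=
  match n with
  | 0 => x0
  | m.+1 => let xm := sol f g h x0 xi m w in
            xm * (1 + h * f xm + Num.sqrt h * g xm * xi m w)
  end.

(* Main.v *)
Require Import Defs.
From HB Require Import structures.
From mathcomp Require Import all_boot all_order all_algebra.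
From mathcomp Require Import all_classical all_reals all_analysis.
From mathcomp Require Import measurable_realfun ring lra.
Import Order.TTheory GRing.Theory Num.Theory.
Import numFieldNormedType.Exports.
Local Open Scope classical_set_scope.
Local Open Scope ring_scope.

(** With [b = max(beta, 0)] and [a = (1 - b) / 2], the function [`|u| `^ a] is a
Lyapunov function.  The cubic bound
[`|1 + x| `^ a <= 1 + a x - a (1 - a) / 2 x^2 + 2 |x|^3], valid for all real [x],
together with the three moments of the noise, shows that for small [h] one step
multiplies the conditional mean of [`|x_n| `^ a] by at most
[1 - c h (|f| + g^2)].  Summing up, [`|x_n| `^ a * (|f| + g^2)(x_n)] is almost
surely summable, hence tends to [0].  The same estimate for the chain stopped
when it leaves [(-M, M)] is a maximal inequality, so [x_n] is almost surely
bounded.  As [|f| + g^2] is continuous and positive off [0], a bounded orbit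
along which the dissipation vanishes must converge to [0]. *)

(** * Cubic upper bound for powers of [1 + x] *)

Lemma derive_ge0_le (R : realType) (F dF : R -> R) (a b : R) : a <= b ->
  (forall x, a <= x <= b -> is_derive x 1 F (dF x)) ->
  (forall x, a < x < b -> 0 <= dF x) -> F a <= F b.
Proof.
rewrite le_eqVlt => /predU1P[->//|ab] dFP dF0.
have dFoo x : x \in `]a, b[ -> is_derive x 1 F (dF x).
  by rewrite in_itv/= => /andP[/ltW ax /ltW xb]; apply: dFP; rewrite ax.
have cF : {within `[a, b], continuous F}.
  apply: derivable_within_continuous => x; rewrite in_itv/= => xab.
  by apply: ex_derive; exact: dFP.
have [x xab] := MVT ab dFoo cF.
move=> FE; rewrite -subr_ge0 FE mulr_ge0 ?subr_ge0 ?(ltW ab)//.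
by apply: dF0; rewrite !(itvP xab).
Qed.

(** Taking logarithms turns the comparison of a power with a polynomial into one whose derivative is
    rational, so its sign can be read off. *)
Lemma ln_cubic_derive (R : realType) (a e x : R) :
  let Q := fun y : R => 1 + a * y - a * (1 - a) / 2 * y ^+ 2 + e * y ^+ 3 in
  -1 < x -> 0 < Q x ->
  is_derive x 1 (fun y => ln (Q y) - a * ln (1 + y))
    ((a - a * (1 - a) * x + 3 * e * x ^+ 2) / Q x - a / (1 + x)).
Proof.
move=> Q x1 Qx.
have dx := is_derive_id x (1 : R).
have dQ : is_derive x 1 Q (a - a * (1 - a) * x + 3 * e * x ^+ 2).
  have := is_deriveD (is_deriveB
    (is_deriveD (is_derive_cst (1 : R) x 1) (is_deriveZ a dx))
    (is_deriveZ (a * (1 - a) / 2) (is_deriveX 2 dx)))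
    (is_deriveZ e (is_deriveX 3 dx)).
  move=> H; apply: (@is_derive_eq _ _ _ Q x 1 _ _ H).
  by rewrite /GRing.scale/=; field.
have d1 : is_derive x 1 (fun y : R => 1 + y) 1.
  have := is_deriveD (is_derive_cst (1 : R) x 1) (is_derive_id x (1 : R)).
  by rewrite add0r.
have x10 : 0 < 1 + x by lra.
have l1 := is_derive1_ln x10.
have lQ := is_derive1_ln Qx.
have c1 := @is_derive1_comp _ (@ln R) Q x _ _ lQ dQ.
have c2 := @is_derive1_comp _ (@ln R) (fun y : R => 1 + y) x _ _ l1 d1.
have H := is_deriveB c1 (is_deriveZ a c2).
apply: (@is_derive_eq _ _ _ (fun y => ln (Q y) - a * ln (1 + y)) x 1 _ _ H).
by rewrite /GRing.scale/= mulr1; congr (_ - _); rewrite mulrC.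
Qed.

(** The logarithms of the two sides agree at 0, and the derivative of their difference is
    nonnegative to the right of 0 and nonpositive to the left. *)
Lemma powR_le_cubic_gtN1 (R : realType) (a x : R) : 0 < a -> a <= 1 / 2 -> -1 < x ->
  (1 + x) `^ a <= 1 + a * x - a * (1 - a) / 2 * x ^+ 2 + `|x| ^+ 3.
Proof.
move=> a0 a12 x1.
(* With [e] the sign of the argument, [e * y ^+ 3] is its absolute cube, so on each side of 0 the
   bound is a polynomial. *)
pose Q (e y : R) := 1 + a * y - a * (1 - a) / 2 * y ^+ 2 + e * y ^+ 3.
have kE : 0 < a * (1 - a) / 2 <= 1 / 8.
  apply/andP; split; nra.
have Qp (y : R) : 0 <= y -> 0 < Q 1 y.
  move=> y0; rewrite /Q; set k := a * (1 - a) / 2 in kE *.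
  case: (lerP y 1) => y1; nra.
have Qn (y : R) : -1 < y <= 0 -> 0 < Q (-1) y.
  move=> y0; rewrite /Q; set k := a * (1 - a) / 2 in kE *.
  have : (- y) ^+ 3 >= 0 by rewrite exprn_ge0//; lra.
  nra.
have x10 : 0 < 1 + x by lra.
suff: exists2 e : R, e * x ^+ 3 = `|x| ^+ 3 & 0 < Q e x /\
    0 <= ln (Q e x) - a * ln (1 + x).
  move=> [e eE [Qx]]; rewrite subr_ge0 => H.
  rewrite -eE -/(Q e x) -[leRHS]lnK ?posrE//.
  by rewrite /powR gt_eqF// ler_expR.
have D0 e : ln (Q e 0) - a * ln (1 + 0) = 0.
  by rewrite /Q !mulr0 !expr0n/= !mulr0 subr0 !addr0 ln1 mulr0 subrr.
(* The constant and linear terms cancel: this fixes the coefficients of [Q]. *)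
have E e y : -1 < y -> 0 < Q e y ->
    (a - a * (1 - a) * y + 3 * e * y ^+ 2) / Q e y - a / (1 + y) =
    y ^+ 2 * (3 * e - a * (1 - a) + a ^+ 2 * (1 - a) / 2 + (3 - a) * e * y)
     / (Q e y * (1 + y)).
  move=> y1 Qy; have ? : 1 + y != 0 by rewrite gt_eqF//; lra.
  have := Qy; rewrite /Q => Qy'.
  by field; apply/andP; split => //; rewrite gt_eqF//; lra.
(* These two bounds settle the sign of the bracket in [E]: nonnegative for [e = 1] and [y > 0],
   nonpositive for [e = -1] and [-1 < y < 0], where [(3 - a) * - y < 3]. *)
have k2 : 0 <= a ^+ 2 * (1 - a) / 2 by nra.
have k3 : a ^+ 2 * (1 - a) / 2 <= a * (1 - a) by nra.
case: (lerP 0 x) => x0.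
- exists 1; first by rewrite mul1r ger0_norm.
  split; first exact: Qp.
  rewrite -(D0 1).
  apply: (@derive_ge0_le _ (fun y => ln (Q 1 y) - a * ln (1 + y)) _ 0 x x0).
  + by move=> y y0; apply: ln_cubic_derive; [lra|apply: Qp; lra].
  + move=> y y0.
    have y1 : -1 < y by lra.
    have Qy : 0 < Q 1 y by apply: Qp; lra.
    rewrite (E 1 y y1 Qy).
    apply: divr_ge0.
    * by apply: mulr_ge0; [exact: sqr_ge0|nra].
    * by apply: mulr_ge0; [exact: ltW|lra].
- exists (-1); first by rewrite ltr0_norm//; ring.
  split; first by apply: Qn; lra.
  rewrite -(D0 (-1)) -lerN2.
  apply: (@derive_ge0_le _ (fun y => - (ln (Q (-1) y) - a * ln (1 + y))) _
    x 0 (ltW x0)).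
  + move=> y y0; apply: is_deriveN.
    by apply: ln_cubic_derive; [lra|apply: Qn; lra].
  + move=> y y0.
    have y1 : -1 < y by lra.
    have Qy : 0 < Q (-1) y by apply: Qn; lra.
    rewrite (E _ y y1 Qy) -mulNr -mulrN.
    apply: divr_ge0.
    * by apply: mulr_ge0; [exact: sqr_ge0|nra].
    * by apply: mulr_ge0; [exact: ltW|lra].
Qed.

Lemma powR_norm_le_cubic (R : realType) (a x : R) : 0 < a -> a <= 1 / 2 ->
  `|1 + x| `^ a <= 1 + a * x - a * (1 - a) / 2 * x ^+ 2 + 2 * `|x| ^+ 3.
Proof.
move=> a0 a12; case: (ltrP (-1) x) => x1.
  rewrite ger0_norm; last by lra.
  apply: (le_trans (powR_le_cubic_gtN1 _ _ _ a0 a12 x1)).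
  have : 0 <= `|x| ^+ 3 by rewrite exprn_ge0.
  lra.
have kE : 0 < a * (1 - a) / 2 <= 1 / 8.
  apply/andP; split; nra.
rewrite ler0_norm; last by lra.
rewrite (@ler0_norm _ x); last by lra.
have h : (- (1 + x)) `^ a <= (- x) `^ a.
  by apply: ge0_ler_powR; rewrite ?nnegrE; lra.
apply: (le_trans h).
apply: (@le_trans _ _ (- x)); first by apply: ler1_powR; lra.
set k := a * (1 - a) / 2 in kE *.
have : 0 <= (- x) ^+ 2 * (- x - 1) by rewrite mulr_ge0 ?sqr_ge0//; lra.
nra.
Qed.

(** * Moment estimate and drift of one step *)

Lemma normD_cube_le (R : realType) (x y : R) :
  `|x + y| ^+ 3 <= 4 * (`|x| ^+ 3 + `|y| ^+ 3).
Proof.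
apply: (@le_trans _ _ ((`|x| + `|y|) ^+ 3)).
  by rewrite lerXn2r ?nnegrE ?addr_ge0// ler_normD.
(* For [s, t >= 0], [4 (s^3 + t^3) - (s + t)^3 = 3 (s + t) (s - t)^2]. *)
have : 0 <= (`|x| + `|y|) * (`|x| - `|y|) ^+ 2.
  by rewrite mulr_ge0 ?addr_ge0 ?sqr_ge0.
nra.
Qed.

(** The first two moments of [X] evaluate the linear and quadratic terms of the cubic bound exactly;
    [C] enters only through the cubic error. *)
Lemma expectation_powR_le (d : measure_display) (T : measurableType d)
    (R : realType) (P : probability T R) (X : {RV P >-> R}) (C a p q : R) :
  ('E_P[X] = 0)%E -> ('E_P[(fun w => (X w ^+ 2)%R)] = 1)%E ->
  ('E_P[(fun w => (`|X w| ^+ 3)%R)] <= C%:E)%E ->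
  0 < a -> a <= 1 / 2 ->
  (\int[P]_w (`|1 + (p + q * X w)| `^ a)%:E <=
   (1 + a * p + 8 * `|p| ^+ 3 - a * (1 - a) / 2 * q ^+ 2
     + 8 * `|q| ^+ 3 * C)%:E)%E.
Proof.
rewrite unlock => EX EX2 EX3 a0 a12.
have mX : measurable_fun setT (X : T -> R) by [].
have iX2 : P.-integrable setT (EFin \o (fun w => X w ^+ 2)).
  apply/integrableP; split; first exact/measurable_EFinP/measurable_funX.
  under eq_integral do rewrite /= ger0_norm ?sqr_ge0//.
  by rewrite EX2 ltry.
have iX3 : P.-integrable setT (EFin \o (fun w => `|X w| ^+ 3)).
  apply/integrableP; split.
    by apply/measurable_EFinP/measurable_funX; exact: measurableT_comp.
  under eq_integral do rewrite /= ger0_norm ?exprn_ge0//.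
  by rewrite (le_lt_trans EX3) ?ltry.
have i1 (c : R) : P.-integrable setT (EFin \o (fun _ => c)).
  exact: finite_measure_integrable_cst.
have iX : P.-integrable setT (EFin \o X).
  apply: (le_integrable measurableT _ _ (integrableD measurableT (i1 1) iX2)).
    exact/measurable_EFinP.
  move=> w _ /=; rewrite lee_fin (@ger0_norm _ (1 + _)).
    have : 0 <= (`|X w| - 1) ^+ 2 by exact: sqr_ge0.
    rewrite -(real_normK (num_real (X w))); nra.
  by rewrite addr_ge0 ?sqr_ge0.
pose k : R := a * (1 - a) / 2.
(* Coefficients of the cubic bound at [p + q * X], by powers of [X]. The 8 is the 2 of
   [powR_norm_le_cubic] times the 4 of [normD_cube_le]; the [A1] term has mean zero. *)
pose A0 : R := 1 + a * p - k * p ^+ 2 + 8 * `|p| ^+ 3.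
pose A1 : R := a * q - 2 * k * p * q.
pose A2 : R := - k * q ^+ 2.
pose A3 : R := 8 * `|q| ^+ 3.
have iX' := integrableZl measurableT A1 iX.
have iX2' := integrableZl measurableT A2 iX2.
have iX3' := integrableZl measurableT A3 iX3.
have iU1 := integrableD measurableT (i1 A0) iX'.
have iU2 := integrableD measurableT iU1 iX2'.
have iU3 := integrableD measurableT iU2 iX3'.
have UP w : `|1 + (p + q * X w)| `^ a <=
    A0 + A1 * X w + A2 * X w ^+ 2 + A3 * `|X w| ^+ 3.
  apply: (le_trans (powR_norm_le_cubic _ _ _ a0 a12)).
  have := normD_cube_le _ p (q * X w).
  rewrite normrM exprMn /A0 /A1 /A2 /A3 -/k => H.
  set Y := `|p + q * X w| ^+ 3 in H *.
  set Z := `|q| ^+ 3 * `|X w| ^+ 3 in H *.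
  rewrite -[8 * _ * _]mulrA -/Z.
  nra.
have intU : (\int[P]_w (A0 + A1 * X w + A2 * X w ^+ 2 + A3 * `|X w| ^+ 3)%:E =
  A0%:E + A2%:E + A3%:E * \int[P]_w (`|X w| ^+ 3)%:E)%E.
  rewrite (integralD measurableT iU2 iX3') (integralD measurableT iU1 iX2').
  rewrite (integralD measurableT (i1 A0) iX') !integralZl//.
  by rewrite integral_cst//= probability_setT mule1 EX EX2 mule0 mule1 adde0.
apply: (@le_trans _ _ (\int[P]_w
    (A0 + A1 * X w + A2 * X w ^+ 2 + A3 * `|X w| ^+ 3)%:E)%E).
  apply: ge0_le_integral => //.
  - apply/measurable_EFinP.
    apply: (@measurableT_comp _ _ _ _ _ _ (fun x : R => x `^ a)).
      exact: measurable_powR.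
    apply: measurableT_comp => //.
    apply: measurable_funD => //; apply: measurable_funD => //.
    exact: measurable_funM.
  - exact: measurable_int iU3.
  - by move=> w _; rewrite lee_fin.
rewrite intU.
apply: (@le_trans _ _ (A0%:E + A2%:E + A3%:E * C%:E)%E).
  by rewrite leeD2l// lee_wpmul2l// lee_fin /A3 mulr_ge0.
rewrite lee_fin /A0 /A2 /A3 -/k.
have : 0 <= k * p ^+ 2 by rewrite mulr_ge0 ?sqr_ge0// /k; nra.
nra.
Qed.

(** With [s = sqrt h], the leading drift has order [s^2] and the cubic errors order at least [s^3].
    The choice of [a] gives [b - (1 - a) = - a], so where [f >= 0] the leading drift is at most
    [- h * a^2 / 2 * g^2]. *)
Lemma drift_le (R : realType) (a b C h f g : R) :
  0 <= b -> b < 1 -> a = (1 - b) / 2 -> 0 <= C ->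
  0 < h -> h < (a ^+ 2 / (48 * (1 + C))) ^+ 2 ->
  `|f| <= 1 -> `|g| <= 1 -> 2 * f <= b * g ^+ 2 ->
  1 + a * (h * f) + 8 * `|h * f| ^+ 3
    - a * (1 - a) / 2 * (Num.sqrt h * g) ^+ 2 + 8 * `|Num.sqrt h * g| ^+ 3 * C
  <= 1 - a ^+ 2 / 6 * h * (`|f| + g ^+ 2).
Proof.
move=> b0 b1 aE C0 h0 hh f1 g1 fg.
set s := Num.sqrt h; have s0 : 0 < s by rewrite sqrtr_gt0.
have hE : h = s ^+ 2 by rewrite sqr_sqrtr// ltW.
set e := a ^+ 2 / (48 * (1 + C)) in hh.
have C1 : 0 < 48 * (1 + C) by lra.
have e0 : 0 <= e by rewrite divr_ge0// ?sqr_ge0// ltW.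
have se : s < e by move: hh; rewrite hE ltr_pXn2r// nnegrE// ltW.
have a01 : 0 < a <= 1 / 2 by lra.
have eC : e * (48 * (1 + C)) = a ^+ 2 by rewrite /e divfK// gt_eqF.
(* The 48 is 8 times 6: the errors, with coefficients 8 and [8 * C], then consume at most half of
   the rate [a^2 / 3] in [D]. *)
have sC : s * (8 + 8 * C) <= a ^+ 2 / 6 by rewrite -eC; nra.
have s1 : s <= 1 by nra.
rewrite !normrM (gtr0_norm h0) (gtr0_norm s0) !exprMn.
have F3 : `|f| ^+ 3 <= `|f|.
  by rewrite -[leRHS]expr1 ler_wiXn2l.
have G3 : `|g| ^+ 3 <= g ^+ 2.
  by rewrite -(real_normK (num_real g)) ler_wiXn2l.
have g20 := sqr_ge0 g.
have nf0 := normr_ge0 f.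
(* For [f >= 0], domination gives [|f| <= g^2 / 2], hence [|f| + g^2 <= 3/2 g^2], which turns
   [a^2 / 2] into [a^2 / 3]. For [f < 0] both terms have the right sign by themselves. *)
have D : a * f - a * (1 - a) / 2 * g ^+ 2 <= - (a ^+ 2 / 3) * (`|f| + g ^+ 2).
  have b_E : b = 1 - 2 * a by lra.
  case: (lerP 0 f) => fs.
    have : 0 <= (a + a ^+ 2 / 3) * (b * g ^+ 2 - 2 * f).
      by rewrite mulr_ge0//; nra.
    have : 0 <= a ^+ 3 * g ^+ 2 by rewrite mulr_ge0// exprn_ge0//; lra.
    rewrite ger0_norm// b_E; lra.
  have : 0 <= (a - a ^+ 2 / 3) * - f by rewrite mulr_ge0//; nra.
  have : 0 <= (a * (1 - a) / 2 - a ^+ 2 / 3) * g ^+ 2 by rewrite mulr_ge0//; nra.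
  rewrite ltr0_norm//; lra.
have E : 8 * (h ^+ 3 * `|f| ^+ 3) + 8 * (s ^+ 3 * `|g| ^+ 3) * C
    <= h * (a ^+ 2 / 6) * (`|f| + g ^+ 2).
  have H1 : 8 * (h ^+ 3 * `|f| ^+ 3) <= h * (8 * s * `|f|).
    have : h ^+ 3 * `|f| ^+ 3 <= h * s * `|f|.
      apply: ler_pM => //; rewrite ?exprn_ge0 ?(ltW h0)//.
      by rewrite hE -exprM -exprSr ler_wiXn2l// ltW.
    nra.
  have H2 : 8 * (s ^+ 3 * `|g| ^+ 3) * C <= h * (8 * s * g ^+ 2 * C).
    have : s ^+ 3 * `|g| ^+ 3 <= h * s * g ^+ 2.
      by rewrite hE -exprSr ler_wpM2l// exprn_ge0// ltW.
    nra.
  have H3 : 8 * s * `|f| + 8 * s * g ^+ 2 * C <= (a ^+ 2 / 6) * (`|f| + g ^+ 2).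
    have : 0 <= s * C by nra.
    have : 0 <= s * C * `|f| by rewrite !mulr_ge0// ltW.
    have : 0 <= s * g ^+ 2 by rewrite mulr_ge0// ltW.
    nra.
  nra.
have hD := ler_wpM2l (ltW h0) D.
rewrite -hE.
nra.
Qed.

(** * Independence of the current state and the coming noise *)

(** The finite measures [m1] and [m2] agree on rectangles, which are stable under intersection and
    generate the product sigma-algebra. *)
Lemma indep_event_pair (d d1 d2 : measure_display) (T : measurableType d)
    (T1 : measurableType d1) (T2 : measurableType d2) (R : realType)
    (P : probability T R) (X : T -> T1) (Y : T -> T2) (E : set T) :
  measurable_fun setT X -> measurable_fun setT Y -> measurable E ->
  (forall A B, measurable A -> measurable B ->
    P (X @^-1` A `&` Y @^-1` B `&` E) = (P (X @^-1` A `&` Y @^-1` B) * P E)%E) ->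
  forall C, measurable C ->
  P ((fun w => (X w, Y w)) @^-1` C `&` E) =
  (P ((fun w => (X w, Y w)) @^-1` C) * P E)%E.
Proof.
move=> mX mY mE XYE C mC.
have mZ : measurable_fun setT (fun w => (X w, Y w)).
  exact: measurable_fun_pair.
pose Z : {mfun T >-> (T1 * T2)%type} :=
  HB.pack (fun w => (X w, Y w)) (isMeasurableFun.Build _ _ _ _ _ mZ).
have PE0 : 0 <= fine (P E) by exact: fine_ge0.
pose m1_ : {measure set (T1 * T2) -> \bar R} := pushforward (mrestr P mE) Z.
pose m1 := m1_ mZ.
pose m2 : {measure set (T1 * T2) -> \bar R} :=
  mscale (NngNum PE0) (distribution P Z).
have m2E D : m2 D = (P (Z @^-1` D) * P E)%E.
  by rewrite /m2/= /mscale/= fineK ?fin_num_measure// muleC.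
rewrite -[RHS]m2E -[LHS]/(m1 C).
apply: (@measure_unique _ R (T1 * T2)%type
  [set A `*` B | A in measurable & B in measurable] (fun=> setT)) => //.
- exact: measurable_prod_measurableType.
- move=> _ _ [A1 mA1 [B1 mB1 <-]] [A2 mA2 [B2 mB2 <-]].
  exists (A1 `&` A2); first exact: measurableI.
  by exists (B1 `&` B2); [exact: measurableI|rewrite setXI].
- by move=> _; exists setT => //; exists setT => //; rewrite setXTT.
- by rewrite bigcup_const//; exists 0%N.
- by move=> _ [A mA [B mB <-]]; rewrite m2E; exact: XYE.
- move=> _; rewrite /m1/= /pushforward/= /mrestr.
  by rewrite preimage_setT setTI (le_lt_trans (probability_le1 _ _)) ?ltry.
Qed.

Lemma measurable_sol (d : measure_display) (T : measurableType d) (R : realType)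
    (P : probability T R) (f g : R -> R) (h x0 : R) (xi : nat -> {RV P >-> R}) n :
  measurable_fun setT f -> measurable_fun setT g ->
  measurable_fun setT (sol f g h x0 xi n).
Proof.
move=> mf mg; elim: n => [|n IH]; first exact: measurable_cst.
apply: measurable_funM => //; apply: measurable_funD.
  apply: measurable_funD => //; apply: measurable_funM => //.
  exact: measurableT_comp.
apply: measurable_funM => //; apply: measurable_funM => //.
exact: measurableT_comp.
Qed.

(** The state at time [n] involves only noises of index below [n]. The list [s] is arbitrary for the
    induction: the claim for [n.+1] and [s] uses the one for [n] and [n :: s]. *)
Lemma sol_indep (d : measure_display) (T : measurableType d) (R : realType)
    (P : probability T R) (f g : R -> R) (h x0 : R) (xi : nat -> {RV P >-> R}) n
    (A : set R) (s : seq nat) (B : nat -> set R) :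
  measurable_fun setT f -> measurable_fun setT g -> mutually_independent xi ->
  measurable A -> (forall i, measurable (B i)) -> uniq s -> all (leq n) s ->
  P (sol f g h x0 xi n @^-1` A `&` \bigcap_(i in [set` s]) (xi i @^-1` B i)) =
  (P (sol f g h x0 xi n @^-1` A) *
   P (\bigcap_(i in [set` s]) (xi i @^-1` B i)))%E.
Proof.
move=> mf mg ind; elim: n A s B => [|n IH] A s B mA mB us ns.
  rewrite preimage_cst; case: ifPn => _.
    by rewrite setTI probability_setT mul1e.
  by rewrite set0I measure0 mul0e.
set E := \bigcap_(i in _) _.
have mxi i (D : set R) : measurable D -> measurable (xi i @^-1` D).
  by move=> mD; rewrite -[_ @^-1` _]setTI; exact: measurable_funP.
have mE : measurable E.
  by rewrite /E bigcap_seq; apply: bigsetI_measurable => i _; exact: mxi.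
pose phi (z : R * R) := z.1 * (1 + h * f z.1 + Num.sqrt h * g z.1 * z.2).
have mphi : measurable_fun setT phi.
  apply: measurable_funM => //; apply: measurable_funD.
    apply: measurable_funD => //; apply: measurable_funM => //.
    exact: measurableT_comp.
  apply: measurable_funM => //; apply: measurable_funM => //.
  exact: measurableT_comp.
have mphiA : measurable (phi @^-1` A) by rewrite -[_ @^-1` _]setTI; exact: mphi.
have -> : sol f g h x0 xi n.+1 @^-1` A =
  (fun w => (sol f g h x0 xi n w, xi n w)) @^-1` (phi @^-1` A) by [].
apply: indep_event_pair => //; first exact: measurable_sol.
move=> A' B' mA' mB'.
have ns' : n \notin s.
  by apply/negP => /(allP ns); rewrite ltnn.
(* A single family of sets for the list [n :: s]: [B'] at index [n], [B] elsewhere. Every index in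
   [s] exceeds [n], so they do not clash. *)
have mB2 i : measurable (if i == n then B' else B i) by case: ifP.
have consE : \bigcap_(i in [set` n :: s])
    (xi i @^-1` (if i == n then B' else B i)) = xi n @^-1` B' `&` E.
  rewrite /E !bigcap_seq big_cons eqxx; congr (_ `&` _).
  apply: eq_big_seq => i si; case: eqP => // ni.
  by move: ns'; rewrite -ni si.
have oneE : \bigcap_(i in [set` [:: n]]) (xi i @^-1` B') = xi n @^-1` B'.
  by rewrite bigcap_seq big_seq1.
have := IH A' [:: n] (fun=> B') mA' (fun=> mB') isT.
rewrite oneE /= leqnn => -> //.
have := IH A' (n :: s) _ mA' mB2.
rewrite consE setIA => -> /=; last 2 first.
- by rewrite ns'.
- by rewrite leqnn/=; apply: sub_all ns => i /ltnW.
rewrite -muleA; congr (_ * _)%E.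
rewrite -consE ind//=; last by rewrite ns'.
rewrite big_cons eqxx; congr (_ * _)%E.
rewrite /E ind//; apply: eq_big_seq => i si; case: eqP => // ni.
by move: ns'; rewrite -ni si.
Qed.

(** Independence makes the joint law of state and next noise a product, and Tonelli integrates the
    noise out with the state frozen. This stands in for conditional expectation. *)
Lemma sol_succ_integral (d : measure_display) (T : measurableType d)
    (R : realType) (P : probability T R) (f g : R -> R) (h x0 : R)
    (xi : nat -> {RV P >-> R}) n (F : R * R -> \bar R) :
  measurable_fun setT f -> measurable_fun setT g -> mutually_independent xi ->
  measurable_fun setT F -> (forall z, 0 <= F z)%E ->
  (\int[P]_w F (sol f g h x0 xi n w, xi n w) =
   \int[P]_w \int[P]_w' F (sol f g h x0 xi n w, xi n w'))%E.
Proof.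
move=> mf mg ind mF F0.
have mx := measurable_sol _ _ _ P f g h x0 xi n mf mg.
pose X : {mfun T >-> R} := HB.pack (sol f g h x0 xi n)
  (isMeasurableFun.Build _ _ _ _ _ mx).
have mZ : measurable_fun setT (fun w => (X w, xi n w)).
  exact: measurable_fun_pair.
pose Z : {mfun T >-> (R * R)%type} :=
  HB.pack (fun w => (X w, xi n w)) (isMeasurableFun.Build _ _ _ _ _ mZ).
rewrite -[LHS](@ge0_integral_distribution _ _ _ _ _ P Z F)//.
rewrite (eq_measure_integral (distribution P X \x distribution P (xi n))%E);
    last first.
  move=> C mC _; apply/esym; apply: product_measure_unique => // A B mA mB.
  have := sol_indep _ _ _ P f g h x0 xi n A [:: n] (fun=> B) mf mg ind mA
    (fun=> mB) isT.
  by rewrite bigcap_seq big_seq1 /= leqnn => /(_ isT).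
rewrite fubini_tonelli1//.
rewrite ge0_integral_distribution//; last first.
- by move=> x; exact: integral_ge0.
- exact: measurable_fun_fubini_tonelli_F.
apply: eq_integral => w _; rewrite /= /fubini_F ge0_integral_distribution//.
exact: measurableT_comp.
Qed.

Lemma expectation_step_le (d : measure_display) (T : measurableType d)
    (R : realType) (P : probability T R) (X : {RV P >-> R}) (a b C h f g : R) :
  ('E_P[X] = 0)%E -> ('E_P[(fun w => (X w ^+ 2)%R)] = 1)%E ->
  ('E_P[(fun w => (`|X w| ^+ 3)%R)] <= C%:E)%E ->
  0 <= b -> b < 1 -> a = (1 - b) / 2 -> 0 <= C ->
  0 < h -> h < (a ^+ 2 / (48 * (1 + C))) ^+ 2 ->
  `|f| <= 1 -> `|g| <= 1 -> 2 * f <= b * g ^+ 2 ->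
  (\int[P]_w (`|1 + h * f + Num.sqrt h * g * X w| `^ a)%:E <=
   (1 - a ^+ 2 / 6 * h * (`|f| + g ^+ 2))%:E)%E.
Proof.
move=> EX EX2 EX3 b0 b1 aE C0 h0 hh f1 g1 fg.
under eq_integral do rewrite -addrA.
apply: (le_trans (expectation_powR_le _ _ _ _ _ _ _ _ _ EX EX2 EX3 _ _)).
- by lra.
- by lra.
- by rewrite lee_fin; exact: (drift_le _ _ b).
Qed.

(** * Decrease of the Lyapunov function along the chain *)

Definition noise_moments {d : measure_display} {T : measurableType d}
    {R : realType} {P : probability T R} (xi : nat -> {RV P >-> R}) (C : R) :=
  [/\ mutually_independent xi,
      (forall n, 'E_P[xi n] = 0)%E,
      (forall n, 'E_P[(fun w => (xi n w ^+ 2)%R)] = 1)%E &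
      (forall n, 'E_P[(fun w => (`|xi n w| ^+ 3)%R)] <= C%:E)%E].

(** Measurability instead of continuity, and a product instead of a quotient, let this class contain
    coefficients cut to 0 outside an interval. At a nonzero [u] with [g u = 0] the last clause reads
    [f u <= 0]. *)
Definition coefs_dominated {R : realType} (b : R) (f g : R -> R) :=
  [/\ measurable_fun setT f, measurable_fun setT g,
      (forall u, `|f u| <= 1), (forall u, `|g u| <= 1) &
      (forall u, u != 0 -> 2 * f u <= b * g u ^+ 2)].

(* The bound on [h] makes the cubic error of one step at most half its drift. *)
Definition step_admissible {R : realType} (a b C h : R) :=
  [/\ 0 <= b < 1, a = (1 - b) / 2, 0 <= C, 0 < h &
      h < (a ^+ 2 / (48 * (1 + C))) ^+ 2].

Definition lyapunov {R : realType} (a u : R) := `|u| `^ a.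

(** The guaranteed fall of the conditional mean of [lyapunov a] in one step from [u], at the rate
    found in [drift_le]. *)
Definition dissipation {R : realType} (a h : R) (f g : R -> R) (u : R) :=
  `|u| `^ a * (a ^+ 2 / 6 * h * (`|f u| + g u ^+ 2)).

Lemma measurable_lyapunov (R : realType) (a : R) :
  measurable_fun setT (lyapunov a).
Proof.
by apply: (@measurableT_comp _ _ _ _ _ _ (fun x : R => x `^ a)).
Qed.

Lemma measurable_dissipation (R : realType) (a b h : R) (f g : R -> R) :
  coefs_dominated b f g -> measurable_fun setT (dissipation a h f g).
Proof.
move=> [mf mg _ _ _]; apply: measurable_funM; first exact: measurable_lyapunov.
apply: measurable_funM => //; apply: measurable_funD.
  exact: measurableT_comp.
exact: measurable_funX.
Qed.

Lemma lyapunov_ge0 (R : realType) (a u : R) : 0 <= lyapunov a u.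
Proof. exact: powR_ge0. Qed.

Lemma dissipation_ge0 (R : realType) (a h : R) (f g : R -> R) (u : R) :
  0 <= h -> 0 <= dissipation a h f g u.
Proof.
move=> h0; apply: mulr_ge0; first exact: powR_ge0.
apply: mulr_ge0; last by rewrite addr_ge0 ?sqr_ge0.
by apply: mulr_ge0 => //; rewrite divr_ge0 ?sqr_ge0.
Qed.

(** By multiplicativity of powers, the new value of [lyapunov] is the old one times the random
    factor [k], whose mean for a frozen state is bounded by [expectation_step_le]. *)
Lemma sol_lyapunov_decrease (d : measure_display) (T : measurableType d)
    (R : realType) (P : probability T R) (f g : R -> R)
    (xi : nat -> {RV P >-> R}) (a b C h x0 : R) n :
  noise_moments xi C -> coefs_dominated b f g ->
  step_admissible a b C h ->
  (\int[P]_w (lyapunov a (sol f g h x0 xi n.+1 w))%:E +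
   \int[P]_w (dissipation a h f g (sol f g h x0 xi n w))%:E <=
   \int[P]_w (lyapunov a (sol f g h x0 xi n w))%:E)%E.
Proof.
move=> [ind EX EX2 EX3] cfg [/andP[b0 b1] aE C0 h0 hh].
have mD := measurable_dissipation R a b h f g cfg.
have D0 u := dissipation_ge0 R a h f g u (ltW h0).
case: cfg => mf mg f1 g1 fg.
set x := sol f g h x0 xi; pose V := lyapunov a.
pose G u := a ^+ 2 / 6 * h * (`|f u| + g u ^+ 2).
have a0 : 0 < a by lra.
have mx : measurable_fun setT (x n) by exact: measurable_sol.
have mV : measurable_fun setT V by exact: measurable_lyapunov.
have V0 u : 0 <= V u by exact: powR_ge0.
pose k (z : R * R) := `|1 + h * f z.1 + Num.sqrt h * g z.1 * z.2| `^ a.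
have mk : measurable_fun setT k.
  apply: (@measurableT_comp _ _ _ _ _ _ (fun x : R => x `^ a)).
    exact: measurable_powR.
  apply: measurableT_comp => //; apply: measurable_funD.
    apply: measurable_funD => //; apply: measurable_funM => //.
    exact: measurableT_comp.
  apply: measurable_funM => //; apply: measurable_funM => //.
  exact: measurableT_comp.
pose F (z : R * R) := (V z.1 * k z)%:E.
have mF : measurable_fun setT F.
  by apply/measurable_EFinP; apply: measurable_funM => //; exact: measurableT_comp.
have F0 z : (0 <= F z)%E by rewrite lee_fin mulr_ge0// powR_ge0.
have -> : (\int[P]_w (lyapunov a (x n.+1 w))%:E = \int[P]_w F (x n w, xi n w))%E.
  by apply: eq_integral => w _; rewrite /F /V /lyapunov /k /x /= normrM powRM.
rewrite sol_succ_integral//.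
pose H (u : R) := (\int[P]_w F (u, xi n w))%E.
have mH : measurable_fun setT H.
  apply: (@measurable_fun_fubini_tonelli_F _ _ _ _ _ P
    (fun z => F (z.1, xi n z.2))) => //=.
  apply: (measurableT_comp mF); apply: measurable_fun_pair => //.
  exact: measurableT_comp.
have H0 u : (0 <= H u)%E by exact: integral_ge0.
have HP u : (H u + (dissipation a h f g u)%:E <= (V u)%:E)%E.
  rewrite -[dissipation _ _ _ _ _]/(V u * G u).
  have -> : H u = ((V u)%:E * \int[P]_w (k (u, xi n w))%:E)%E.
    rewrite /H /F /=; under eq_integral do rewrite EFinM.
    rewrite ge0_integralZl//; last by rewrite lee_fin.
    - by apply/measurable_EFinP; apply: (measurableT_comp mk); exact: measurable_fun_pair.
    - by move=> w _; rewrite lee_fin powR_ge0.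
  (* Domination says nothing at 0, but there both sides vanish because [a > 0]. *)
  have [->|u0] := eqVneq u 0.
    by rewrite /V /lyapunov normr0 powR0 ?gt_eqF// mul0e mul0r adde0.
  have step := expectation_step_le _ _ _ P (xi n) a b C h (f u) (g u) (EX n)
    (EX2 n) (EX3 n) b0 b1 aE C0 h0 hh (f1 u) (g1 u) (fg u u0).
  apply: (@le_trans _ _ ((V u)%:E * (1 - G u)%:E + (V u * G u)%:E)%E).
    by rewrite leeD2r// lee_wpmul2l// lee_fin.
  by rewrite -EFinM -EFinD lee_fin; lra.
rewrite -/x -[X in (X + _)%E]/(\int[P]_w H (x n w))%E -ge0_integralD//=.
- apply: ge0_le_integral => //=.
  + by move=> w _; rewrite adde_ge0// lee_fin.
  + apply: emeasurable_funD; first exact: measurableT_comp.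
    by apply/measurable_EFinP; exact: measurableT_comp.
  + by apply/measurable_EFinP; exact: measurableT_comp.
- exact: measurableT_comp.
- by move=> w _; rewrite lee_fin.
- by apply/measurable_EFinP; exact: measurableT_comp.
Qed.

(** Telescoping of the one-step decrease. The first term serves the maximal inequality, the sum
    serves summability. *)
Lemma sol_lyapunov_budget (d : measure_display) (T : measurableType d)
    (R : realType) (P : probability T R) (f g : R -> R)
    (xi : nat -> {RV P >-> R}) (a b C h x0 : R) n :
  noise_moments xi C -> coefs_dominated b f g ->
  step_admissible a b C h ->
  (\int[P]_w (lyapunov a (sol f g h x0 xi n w))%:E +
   \sum_(0 <= k < n)
     \int[P]_w (dissipation a h f g (sol f g h x0 xi k w))%:E <=
   (lyapunov a x0)%:E)%E.
Proof.
move=> nm cd sa; elim: n => [|n IH].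
  rewrite big_nil adde0 -[leLHS]/(\int[P]_w (cst (lyapunov a x0)%:E w))%E.
  by rewrite integral_cst//= probability_setT mule1.
rewrite big_nat_recr//= addeCA addeC.
apply: (le_trans _ IH); rewrite leeD2r//.
exact: sol_lyapunov_decrease nm cd sa.
Qed.

Lemma sol_dissipation_summable (d : measure_display) (T : measurableType d)
    (R : realType) (P : probability T R) (f g : R -> R)
    (xi : nat -> {RV P >-> R}) (a b C h x0 : R) :
  noise_moments xi C -> coefs_dominated b f g ->
  step_admissible a b C h ->
  (\sum_(0 <= k <oo)
     \int[P]_w (dissipation a h f g (sol f g h x0 xi k w))%:E <=
   (lyapunov a x0)%:E)%E.
Proof.
move=> nm cd sa; have [_ _ _ /ltW h0 _] := sa.
have D0 k : (0 <= \int[P]_w (dissipation a h f g (sol f g h x0 xi k w))%:E)%E.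
  by apply: integral_ge0 => w _; rewrite lee_fin dissipation_ge0.
apply: lime_le; first exact: is_cvg_nneseries.
apply: nearW => n; apply: le_trans (sol_lyapunov_budget _ _ _ _ _ _ _ _ _ _ _ x0 n nm cd sa).
by rewrite leeDr// integral_ge0// => w _; rewrite lee_fin lyapunov_ge0.
Qed.

(** * Stopped chain, maximal inequality and almost sure boundedness *)

(* Stopping both coefficients freezes the chain once it leaves [(-M, M)]. *)
Definition stopped {R : realType} (M : R) (f : R -> R) (u : R) :=
  if `|u| < M then f u else 0.

Lemma measurable_stopped (R : realType) (M : R) (f : R -> R) :
  measurable_fun setT f -> measurable_fun setT (stopped M f).
Proof.
move=> mf; apply: measurable_fun_ifT => //.
by apply: measurable_fun_ltr => //; exact: measurableT_comp.
Qed.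

Lemma coefs_dominated_stopped (R : realType) (b M : R) (f g : R -> R) :
  coefs_dominated b f g ->
  coefs_dominated b (stopped M f) (stopped M g).
Proof.
move=> [mf mg f1 g1 fg]; split; [exact: measurable_stopped|
  exact: measurable_stopped|..] => u; rewrite /stopped; case: ifP => // _.
- by rewrite normr0.
- by rewrite normr0.
- exact: fg.
- by rewrite expr0n/= !mulr0.
Qed.

(** A frozen chain never comes back, so being inside at time [n] means never having left, and until
    then the two chains coincide. *)
Lemma sol_stoppedP (d : measure_display) (T : measurableType d) (R : realType)
    (P : probability T R) (f g : R -> R) (h x0 M : R)
    (xi : nat -> {RV P >-> R}) n (w : T) :
  `|sol (stopped M f) (stopped M g) h x0 xi n w| < M ->
  sol (stopped M f) (stopped M g) h x0 xi n w = sol f g h x0 xi n w /\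
  forall k, (k <= n)%N -> `|sol f g h x0 xi k w| < M.
Proof.
elim: n => [|n IH] /=; first by move=> x0M; split=> // k; rewrite leqn0 => /eqP->.
set y := sol _ _ h x0 xi n w in IH *.
case: (ltrP `|y| M) => yM; last first.
  have sE F : stopped M F y = 0 by rewrite /stopped ltNge yM.
  by rewrite !sE !mulr0 mul0r !addr0 mulr1 ltNge yM.
have sE F : stopped M F y = F y by rewrite /stopped yM.
rewrite !sE.
have [yE IH'] := IH yM; rewrite yE => xM; split=> // k.
by rewrite leq_eqVlt => /predU1P[->//|]; rewrite ltnS; exact: IH'.
Qed.

(** Markov's inequality for the stopped chain at time [n] controls all exits up to [n], with a bound
    independent of [n]. *)
Lemma sol_maximal_ineq (d : measure_display) (T : measurableType d)
    (R : realType) (P : probability T R) (f g : R -> R)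
    (xi : nat -> {RV P >-> R}) (a b C h x0 M : R) :
  noise_moments xi C -> coefs_dominated b f g ->
  step_admissible a b C h -> 0 < M ->
  ((M `^ a)%:E * P [set w | exists n, (M <= `|sol f g h x0 xi n w|)%R] <=
   (lyapunov a x0)%:E)%E.
Proof.
move=> nm cd sa M0.
have [mf mg _ _ _] := cd; have [/andP[b0 b1] aE _ _ _] := sa.
have a0 : 0 < a by lra.
have mx n := measurable_sol _ _ _ P f g h x0 xi n mf mg.
pose D n := [set w | exists2 k, (k <= n)%N & M <= `|sol f g h x0 xi k w| ].
have mD n : measurable (D n).
  have -> : D n = \bigcup_(k in `I_n.+1)
      ((fun w => `|sol f g h x0 xi k w|) @^-1` `[M, +oo[).
    apply/seteqP; split=> w.
      by move=> [k kn xk]; exists k => //=; rewrite in_itv/= xk.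
    by move=> [k /= kn]; rewrite in_itv/= andbT => xk; exists k.
  apply: bigcup_measurable => k _; rewrite -[_ @^-1` _]setTI.
  suff : measurable_fun setT (fun w => `|sol f g h x0 xi k w|) by apply.
  exact: measurableT_comp.
have -> : [set w | exists n, M <= `|sol f g h x0 xi n w| ] = \bigcup_n D n.
  apply/seteqP; split=> w; first by move=> [n xn]; exists n => //; exists n.
  by move=> [n _ [k _ xk]]; exists k.
have PD n : (P (D n) <= ((M `^ a)^-1 * lyapunov a x0)%:E)%E.
  have [mf' mg' _ _ _] := coefs_dominated_stopped R b M f g cd.
  have my := measurable_sol _ _ _ P _ _ h x0 xi n mf' mg'.
  pose Y : {RV P >-> R} := HB.pack (sol (stopped M f) (stopped M g) h x0 xi n)
    (isMeasurableFun.Build _ _ _ _ _ my).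
  have mk := @markov _ _ _ P Y (fun u => u `^ a) M M0 (measurable_powR _)
    (fun u _ => powR_ge0 u a) (ge0_ler_powR (ltW a0)).
  have bu := sol_lyapunov_budget _ _ _ _ _ _ _ _ _ _ _ x0 n nm
    (coefs_dominated_stopped R b M f g cd) sa.
  rewrite EFinM lee_pdivlMl ?powR_gt0//.
  apply: (@le_trans _ _ ((M `^ a)%:E * P [set w | M%:E <= `|(Y w)%:E|])%E).
    rewrite lee_wpmul2l ?lee_fin ?powR_ge0// le_measure ?inE//.
    - rewrite [X in measurable X](_ : _ =
          (fun w => `|Y w|) @^-1` `[M, +oo[); last first.
        by apply/seteqP; split=> w /=; rewrite lee_fin in_itv/= andbT.
      rewrite -[_ @^-1` _]setTI.
      suff : measurable_fun setT (fun w => `|Y w|) by apply.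
      exact: measurableT_comp.
    (* Contrapositive of [sol_stoppedP]: once the original chain has reached level [M] by time [n],
       the stopped one is at that level or above at time [n]. *)
    - move=> w [k kn xk] /=; rewrite lee_fin leNgt; apply/negP.
      by move=> /sol_stoppedP[_ /(_ k kn)]; rewrite ltNge xk.
  apply: (le_trans mk); apply: le_trans bu; rewrite unlock leeDl//.
  apply: sume_ge0 => k _; apply: integral_ge0 => w _.
  by rewrite lee_fin dissipation_ge0//; case: sa => _ _ _ /ltW.
rewrite -lee_pdivlMl ?powR_gt0// -EFinM.
have ndD : nondecreasing_seq D.
  move=> m n mn; apply/subsetPset => w [k km xk]; exists k => //.
  exact: leq_trans mn.
have cD := nondecreasing_cvg_mu (mu := P) mD
  (bigcup_measurable (fun k _ => mD k)) ndD.
rewrite -(cvg_lim _ cD)//; apply: lime_le; last exact: nearW.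
by apply/cvg_ex; exists (P (\bigcup_n D n)).
Qed.

(** An unbounded orbit lies in every [D j], and the maximal inequality bounds the probability of
    [D j] by [lyapunov a x0 / j.+1]. *)
Lemma sol_ae_bounded (d : measure_display) (T : measurableType d)
    (R : realType) (P : probability T R) (f g : R -> R)
    (xi : nat -> {RV P >-> R}) (a b C h x0 : R) :
  noise_moments xi C -> coefs_dominated b f g ->
  step_admissible a b C h ->
  {ae P, forall w, exists M : R, forall n, `|sol f g h x0 xi n w| < M}.
Proof.
move=> nm cd sa.
have [mf mg _ _ _] := cd; have [/andP[b0 b1] aE _ _ _] := sa.
have a0 : 0 < a by lra.
(* Levels chosen so that [M j `^ a] is the integer [j.+1]. *)
pose M j : R := j.+1%:R `^ a^-1.
have Ma j : M j `^ a = j.+1%:R by rewrite /M -powRrM mulVf ?gt_eqF// powRr1.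
pose D j := [set w | exists n, M j <= `|sol f g h x0 xi n w| ].
have mD j : measurable (D j).
  have -> : D j = \bigcup_n ((fun w => `|sol f g h x0 xi n w|) @^-1` `[M j, +oo[).
    apply/seteqP; split=> w; first by move=> [n xn]; exists n; rewrite //= in_itv/= xn.
    by move=> [n _ /=]; rewrite in_itv/= andbT; exists n.
  apply: bigcup_measurable => n _; rewrite -[_ @^-1` _]setTI.
  suff : measurable_fun setT (fun w => `|sol f g h x0 xi n w|) by apply.
  by apply: measurableT_comp => //; exact: measurable_sol.
have mN : measurable (\bigcap_j D j) by exact: bigcap_measurable.
exists (\bigcap_j D j); split=> //; last first.
  move=> w /= nw j _; apply: contra_notP nw => nex; exists (M j) => n.
  by rewrite ltNge; apply/negP => xn; apply: nex; exists n.
have PNE : P (\bigcap_j D j) = (fine (P (\bigcap_j D j)))%:E.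
  by rewrite fineK// fin_num_measure.
set p := fine _ in PNE; rewrite PNE; congr _%:E.
have p0 : 0 <= p by exact: fine_ge0.
have pj (j : nat) : j.+1%:R * p <= lyapunov a x0.
  rewrite -lee_fin EFinM -PNE.
  have := sol_maximal_ineq _ _ _ P f g xi a b C h x0 (M j) nm cd sa (powR_gt0 _ (ltr0Sn _ _)).
  rewrite Ma; apply: le_trans; rewrite lee_wpmul2l ?lee_fin//.
  by rewrite le_measure ?inE//; [exact: mD|exact: bigcap_inf].
apply/eqP; rewrite eq_le p0 andbT leNgt; apply/negP => p_gt0.
have := pj (Num.truncn (lyapunov a x0 / p)).
by rewrite leNgt -ltr_pdivrMr// truncnS_gt.
Qed.

(** * Vanishing dissipation and convergence to 0 *)

(** Each term is at most the tail that starts with it, and the tails tend to 0. *)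
Lemma nneseries_lty_cvg0 (R : realType) (u : nat -> R) :
  (forall n, 0 <= u n) -> (\sum_(0 <= n <oo) (u n)%:E < +oo)%E ->
  u n @[n --> \oo] --> (0 : R).
Proof.
move=> u0 su.
have u0' k : xpredT k -> (0 <= (u k)%:E)%E by rewrite lee_fin.
have tl := nneseries_tail_cvg su (fun k => u0' k).
have cu : (u n)%:E @[n --> \oo] --> (0 : R)%:E.
  apply: (squeeze_cvge _ (cvg_cst _) tl); apply: nearW => n.
  rewrite lee_fin u0 /=; apply: (le_trans _ (nneseries_lim_ge n.+1 _)).
    by rewrite big_nat1.
  by move=> k _ _; rewrite lee_fin.
by move/fine_cvgP : cu => [].
Qed.

(** Exchanging sum and integral, the total dissipation along an orbit is integrable, hence almost
    surely finite. *)
Lemma sol_dissipation_ae_cvg0 (d : measure_display) (T : measurableType d)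
    (R : realType) (P : probability T R) (f g : R -> R)
    (xi : nat -> {RV P >-> R}) (a b C h x0 : R) :
  noise_moments xi C -> coefs_dominated b f g ->
  step_admissible a b C h ->
  {ae P, forall w,
    dissipation a h f g (sol f g h x0 xi n w) @[n --> \oo] --> (0 : R)}.
Proof.
move=> nm cd sa; have [_ _ _ /ltW h0 _] := sa; have [mf mg _ _ _] := cd.
pose F n w := (dissipation a h f g (sol f g h x0 xi n w))%:E.
have mF n : measurable_fun setT (F n).
  apply/measurable_EFinP; apply: measurableT_comp; last exact: measurable_sol.
  exact: measurable_dissipation cd.
have F0 n w : (0 <= F n w)%E by rewrite lee_fin dissipation_ge0.
have iF : P.-integrable setT (fun w => \sum_(0 <= n <oo) F n w)%E.
  apply/integrableP; split.
    by apply: ge0_emeasurable_sum.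
  under eq_integral do rewrite gee0_abs ?nneseries_ge0//.
  rewrite integral_nneseries//.
  apply: le_lt_trans (ltry (lyapunov a x0)).
  exact: sol_dissipation_summable nm cd sa.
apply: filterS (integrable_ae measurableT iF) => w /(_ I) Fw.
apply: nneseries_lty_cvg0; first by move=> n; exact: dissipation_ge0.
by rewrite -ge0_fin_numE//; apply: nneseries_ge0 => n _ _; exact: F0.
Qed.

(** On the compact set [e <= |u| <= M] the dissipation has a positive lower bound [q], so a value
    below [q] forces [|x n| < e]. *)
Lemma bounded_dissipation_cvg0 (R : realType) (a h : R) (f g : R -> R)
    (x : nat -> R) (M : R) :
  continuous f -> continuous g -> 0 < a -> 0 < h ->
  (forall u, u != 0 -> g u = 0 -> f u != 0) ->
  (forall n, `|x n| < M) ->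
  dissipation a h f g (x n) @[n --> \oo] --> (0 : R) ->
  x n @[n --> \oo] --> (0 : R).
Proof.
move=> cf cg a0 h0 fg xM Dx; apply/cvgr0Pnorm_lt => e e0.
pose G u : R := `|f u| + g u ^+ 2.
have cG : continuous G.
  move=> u; apply: cvgD; first by apply: cvg_norm; exact: cf.
  by apply: cvgM; exact: cg.
have G0 u : u != 0 -> 0 < G u.
  move=> u0; have [g0|gn0] := eqVneq (g u) 0.
    by rewrite /G ltr_pwDl ?sqr_ge0// normr_gt0 (fg u u0 g0).
  by rewrite /G ltr_wpDl// exprn_even_gt0.
have [eM|Me] := leP e M; last first.
  by apply: nearW => n; rewrite (lt_trans (xM n)).
have [c1 /[!in_itv]/= c1e c1P] := EVT_min eM (continuous_subspaceT cG).
(* The extreme value theorem is applied on the interval from [e] to [M] only; reflecting [G] covers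
   the negative half. *)
have cGN : continuous (G \o -%R).
  by move=> u; apply: continuous_comp; [exact: opp_continuous|exact: cG].
have [c2 /[!in_itv]/= c2e c2P] := EVT_min eM (continuous_subspaceT cGN).
pose m := Num.min (G c1) (G (- c2)).
have m0 : 0 < m by rewrite lt_min !G0// ?oppr_eq0 gt_eqF//; lra.
pose q := e `^ a * (a ^+ 2 / 6 * h * m).
have q0 : 0 < q by rewrite mulr_gt0 ?powR_gt0// !mulr_gt0 ?exprn_gt0 ?invr_gt0.
move/cvgr0Pnorm_lt : Dx => /(_ q q0); apply: filterS => n.
apply: contraTT; rewrite -!leNgt => ex.
apply: le_trans (ler_norm _); apply: ler_pM.
- exact: powR_ge0.
- by rewrite ltW// !mulr_gt0 ?exprn_gt0 ?invr_gt0.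
- by apply: ge0_ler_powR; rewrite ?nnegrE// ltW.
rewrite ler_pM2l ?mulr_gt0 ?exprn_gt0 ?invr_gt0//.
rewrite ge_min; have xMn := xM n.
case: (lerP 0 (x n)) => xs.
  rewrite ger0_norm// in ex xMn.
  by apply/orP; left; apply: c1P; rewrite in_itv/= ex ltW.
rewrite ltr0_norm// in ex xMn.
apply/orP; right; have := c2P (- x n).
by rewrite /= opprK; apply; rewrite in_itv/= ex ltW.
Qed.

Theorem theorem2 (d : measure_display) (T : measurableType d) (R : realType)
  (P : probability T R) (f g : R -> R) (xi : nat -> {RV P >-> R}) :
  continuous f -> continuous g ->
  (forall u, `|f u| <= 1) -> (forall u, `|g u| <= 1) ->
  noise_assumption xi ->
  (exists beta : R, beta < 1 /\
     forall u : R, u != 0 ->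
       (g u != 0 -> 2 * f u / g u ^+ 2 <= beta) /\
       (g u = 0 -> f u < 0)) ->
  exists h0 : R, 0 < h0 /\
    forall h : R, 0 < h -> h < h0 -> forall x0 : R,
      {ae P, forall w, sol f g h x0 xi n w @[n --> \oo] --> (0 : R)}.
Proof.
move=> cf cg f1 g1 [ind EX EX2 [C EX3] _] [beta [beta1 fg]].
(* A negative [beta] is raised to 0, which keeps [a] in [(0, 1/2]], the range of the cubic bound. *)
pose b := Num.max beta 0; pose a := (1 - b) / 2.
have b01 : 0 <= b < 1 by rewrite le_max lexx orbT gt_max beta1 ltr01.
have a0 : 0 < a by rewrite /a; lra.
have C0 : 0 <= C.
  rewrite -lee_fin; apply: le_trans (EX3 0%N).
  by apply: expectation_ge0 => w; exact: exprn_ge0.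
(* This threshold depends only on [beta] and the third-moment bound, hence is uniform in [x0]. *)
exists ((a ^+ 2 / (48 * (1 + C))) ^+ 2); split.
  by rewrite exprn_gt0// divr_gt0 ?exprn_gt0//; lra.
move=> h h0 hh x0.
have nm : noise_moments xi C by split.
have sa : step_admissible a b C h by split.
have cd : coefs_dominated b f g.
  split=> //; [exact: continuous_measurable_fun|exact: continuous_measurable_fun|].
  move=> u u0; have [fgn fg0] := fg u u0.
  have [g0|gn0] := eqVneq (g u) 0.
    by rewrite g0 expr0n/= mulr0; have := fg0 g0; lra.
  rewrite -ler_pdivrMr ?exprn_even_gt0//.
  by rewrite (le_trans (fgn gn0))// le_max lexx.
have bd := sol_ae_bounded _ _ _ P f g xi a b C h x0 nm cd sa.
have dc := sol_dissipation_ae_cvg0 _ _ _ P f g xi a b C h x0 nm cd sa.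
apply: filterS2 bd dc => w [M xM] Dx.
apply: (bounded_dissipation_cvg0 _ _ _ _ _ _ _ cf cg a0 h0 _ xM Dx).
by move=> u u0 gu0; have [_ /(_ gu0) fu] := fg u u0; rewrite lt_eqF.
Qed.
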